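(* Let $k\geq 2$ and $n\geq 1$ be integers. Then $$e^{(k)}_{n}=\sum_{j=1}^{k-1}\left(j\sum_{i=k-1}^{n+k-1-j}F_{i}^{(k)}F_{n+2k-2-j-i}^{(k)}\right).$$
   Context: For $n\geq 1$ and $k\geq 2$, the hypercube $Q_n$ is the graph whose vertices are the binary strings of length $n$, two strings adjacent iff they differ in exactly one coordinate. The $k$-th order Fibonacci cube $\Gamma^{(k)}_n$ is the subgraph of $Q_n$ induced by the binary strings of length $n$ that do not contain $k$ consecutive 1s (i.e. do not contain $1^k$ as a factor); $\Gamma^{(k)}_0$ is the one-vertex graph. Let $e^{(k)}_n=|E(\Gamma^{(k)}_n)|$ denote its number of edges. The $k$-th order Fibonacci numbers are defined by $F_0^{(k)}=\cdots=F_{k-2}^{(k)}=0$, $F_{k-1}^{(k)}=1$, and $F_n^{(k)}=F_{n-1}^{(k)}+F_{n-2}^{(k)}+\cdots+F_{n-k}^{(k)}$ for $n\geq k$. *)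

(* Defs.v *)
From mathcomp Require Import all_boot.

Set Implicit Arguments.
Unset Strict Implicit.
Unset Printing Implicit Defensive.

Definition hypercube_adj (n : nat) : rel (n.-tuple bool) :=
  fun u v => #|[set i : 'I_n | tnth u i != tnth v i]| == 1.

Lemma hypercube_adj_sym n : symmetric (@hypercube_adj n).
Proof.
move=> u v; rewrite /hypercube_adj; congr (_ == 1); apply: eq_card => i.
by rewrite !inE eq_sym.
Qed.

Lemma hypercube_adj_irrefl n : irreflexive (@hypercube_adj n).
Proof.
move=> u; rewrite /hypercube_adj (_ : [set i | _] = set0) ?cards0 //.
by apply/setP => i; rewrite !inE eqxx.
Qed.

(* Edges are unordered pairs, so each one is counted once. *)
Definition induced_edges (T : finType) (e : rel T) (V : {set T}) :
    {set {set T}} :=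
  [set [set u; v] | u in V, v in V & e u v].

Definition fibcube_vertices (k n : nat) : {set n.-tuple bool} :=
  [set u : n.-tuple bool | ~~ infix (nseq k true) u].

Definition fibcube_edges (k n : nat) : {set {set n.-tuple bool}} :=
  induced_edges (@hypercube_adj n) (fibcube_vertices k n).

(* kfibs k n = [:: F_0; ...; F_(n-1)]. The defining equations of the k-th order
   Fibonacci numbers are the lemmas kfib_small, kfib_init and kfib_rec. *)
Fixpoint kfibs (k n : nat) : seq nat :=
  if n is m.+1 then
    let s := kfibs k m in
    rcons s (if m < k.-1 then 0
             else if m == k.-1 then 1
             else \sum_(1 <= j < k.+1) nth 0 s (m - j))
  else [::].

Definition kfib (k n : nat) : nat := nth 0 (kfibs k n.+1) n.

Lemma size_kfibs k n : size (kfibs k n) = n.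
Proof. by elim: n => //= n IHn; rewrite size_rcons IHn. Qed.

Lemma nth_kfibs k n m : m < n -> nth 0 (kfibs k n) m = kfib k m.
Proof.
elim: n => // n IHn; rewrite ltnS leq_eqVlt => /predU1P[-> // | lt_mn].
by rewrite [kfibs _ _]/= nth_rcons size_kfibs lt_mn IHn.
Qed.

Lemma kfib_small k n : n < k.-1 -> kfib k n = 0.
Proof. by rewrite /kfib /= nth_rcons size_kfibs ltnn eqxx => ->. Qed.

Lemma kfib_init k : kfib k k.-1 = 1.
Proof. by rewrite /kfib /= nth_rcons size_kfibs ltnn !eqxx. Qed.

Lemma kfib_rec k n : 0 < k -> k <= n ->
  kfib k n = \sum_(1 <= j < k.+1) kfib k (n - j).
Proof.
move=> k_gt0 le_kn; have lt_n : k.-1 < n by rewrite prednK.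
rewrite {1}/kfib /= nth_rcons size_kfibs ltnn eqxx.
rewrite ltnNge (ltnW lt_n) /= gtn_eqF //.
apply: eq_big_nat => j /andP[j_gt0 _]; apply: nth_kfibs.
by rewrite ltn_subrL j_gt0 (leq_trans k_gt0 le_kn).
Qed.

(* Main.v *)
(* An edge of the Fibonacci cube is a vertex with one of its ones marked: turning
   the marked 1 into a 0 never creates a factor 1^k. So e_n is the total number
   W(n) of ones in all vertices. Splitting off the leading run of ones gives a
   linear recurrence for W(n) with characteristic polynomial that of the
   Fibonacci numbers and an inhomogeneous Fibonacci term; the convolution
   F * F satisfies such a recurrence as well, and a weighted sum of its shifts
   satisfies the one for W(n). *)

Require Import Defs.
From mathcomp Require Import all_boot.
From mathcomp Require Import zify.

Set Implicit Arguments.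
Unset Strict Implicit.
Unset Printing Implicit Defensive.

(** * Words with bounded runs of ones *)

(* Automaton reading [u] from left to right: the leading run of ones has length
   at most [r], every later one length at most [p]. *)
Fixpoint runs_le (p r : nat) (u : seq bool) : bool :=
  if u is b :: u' then
    if b then if r is r'.+1 then runs_le p r' u' else false
    else runs_le p p u'
  else true.

(** As [r <= p], a block of [p.+1] ones at the very start already breaks the bound [r]; only blocks
    inside the tail need a separate test. *)
Lemma runs_leE p r u : r <= p ->
  runs_le p r u =
    ~~ (prefix (nseq r.+1 true) u || infix (nseq p.+1 true) u).
Proof.
elim: u r => [|[] u IHu] r le_rp //.
- case: r le_rp => [|r] le_rp; first by rewrite /= prefix0s.
  rewrite [LHS]/= (IHu r (ltnW le_rp)) infix_consl /= orbA.
  have sub_run : prefix (nseq p true) u -> prefix (nseq r.+1 true) u.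
    apply: prefix_trans; rewrite -(subnKC le_rp) nseqD; exact: prefix_prefix.
  by case: (prefix (nseq p true) u) sub_run => [/(_ isT)/= ->|_]; rewrite ?orbF.
- rewrite /= (IHu p (leqnn p)); congr (~~ _).
  by apply: orb_idl; apply: prefixW.
Qed.

Lemma runs_le_infix p u : runs_le p p u = ~~ infix (nseq p.+1 true) u.
Proof. by rewrite runs_leE // orb_idl //; apply: prefixW. Qed.

(** Erasing a one resets the allowance of [v] to [p] while that of [u] shrinks, so the induction
    must let [v] start with a larger allowance. *)
Lemma runs_le_mono p r s u v : r <= s <= p -> size u = size v ->
  (forall i, nth false v i -> nth false u i) -> runs_le p r u -> runs_le p s v.
Proof.
elim: u r s v => [|b u IHu] r s [|c v] //= le_rsp [eq_sz] sub_vu.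
have sub_tl i : nth false v i -> nth false u i by apply: (sub_vu i.+1).
case: c sub_vu => [/(_ 0 isT) /= -> | _].
  by case: r s le_rsp => [|r] [|s] // le_rsp; apply: IHu => //; lia.
by case: b; [case: r le_rsp => // r le_rsp|]; apply: IHu => //; lia.
Qed.

(** * Edges as vertices with a marked one *)

Definition flip (n : nat) (i : 'I_n) (u : n.-tuple bool) : n.-tuple bool :=
  [tuple (j == i) (+) tnth u j | j < n].

Lemma tnth_flip n (i j : 'I_n) u : tnth (flip i u) j = (j == i) (+) tnth u j.
Proof. exact: tnth_mktuple. Qed.

Lemma flipK n (i : 'I_n) : involutive (flip i).
Proof. by move=> u; apply: eq_from_tnth => j; rewrite !tnth_flip addKb. Qed.

Lemma hypercube_adj_flipP n (u v : n.-tuple bool) :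
  reflect (exists i, v = flip i u) (hypercube_adj u v).
Proof.
apply: (iffP cards1P) => [[i /setP eq_i] | [i ->]]; exists i.
  apply: eq_from_tnth => j; have:= eq_i j; rewrite tnth_flip !inE => <-.
  by case: (tnth u j); case: (tnth v j).
apply/setP => j; rewrite !inE tnth_flip.
by case: (j == i); case: (tnth u j).
Qed.

Lemma fibcube_vertices_flip k n (u : n.-tuple bool) i : 0 < k ->
  u \in fibcube_vertices k n -> tnth u i -> flip i u \in fibcube_vertices k n.
Proof.
case: k => // p _; rewrite !inE -!runs_le_infix => ok_u u_i.
apply: runs_le_mono ok_u; rewrite ?leqnn ?size_tuple //.
move=> j; case: (ltnP j n) => [lt_jn|le_nj]; last first.
  by rewrite nth_default // size_tuple.
rewrite -[j]/(val (Ordinal lt_jn)) -!tnth_nth tnth_flip.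
by case: eqP => [->|].
Qed.

(* Each edge is named once, by its endpoint with more ones together with the
   coordinate at which that endpoint carries the extra one. *)
Lemma card_fibcube_edges k n : 0 < k ->
  #|fibcube_edges k n| = \sum_(u in fibcube_vertices k n) count id u.
Proof.
move=> k_gt0; set V := fibcube_vertices k n.
pose P := [set x : n.-tuple bool * 'I_n | (x.1 \in V) && tnth x.1 x.2].
have -> : fibcube_edges k n = [set [set x.1; flip x.2 x.1] | x in P].
  apply/setP => E; apply/imset2P/imsetP => [[u v uV] | [[u i]]]; last first.
    rewrite inE => /andP[/= uV u_i] ->.
    exists u (flip i u) => //; rewrite inE fibcube_vertices_flip //=.
    by apply/hypercube_adj_flipP; exists i.
  rewrite inE => /andP[vV /hypercube_adj_flipP[i def_v]] ->.
  case u_i: (tnth u i).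
    by exists (u, i); [rewrite inE uV | rewrite /= -def_v].
  exists (v, i); last by rewrite /= setUC def_v flipK.
  by rewrite inE vV def_v tnth_flip eqxx u_i.
rewrite card_in_imset => [|[u i] [v j]]; last first.
  rewrite !inE /= => /andP[_ u_i] /andP[_ v_j] eqE.
  have: u \in [set v; flip j v] by rewrite -eqE !inE eqxx.
  have: flip i u \in [set v; flip j v] by rewrite -eqE !inE eqxx orbT.
  (* Only the third matching of endpoints is consistent. The crossed one (second) would force
     [i = j], making coordinate [i] a one of both ends. *)
  rewrite !inE => /orP[]/eqP eq1 /orP[]/eqP eq2.
  - by move: (congr1 (fun w => tnth w i) eq1); rewrite tnth_flip eqxx -eq2 u_i.
  - move: (congr1 (fun w => tnth w j) eq1) u_i.
    rewrite tnth_flip eq2 !tnth_flip v_j eqxx /=.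
    by rewrite eq_sym; case: (eqVneq i j) => [->|_] /=; rewrite ?v_j.
  - move: (congr1 (fun w => tnth w i) eq1); rewrite eq2 !tnth_flip eqxx.
    by case: eqP => [->|_] //; case: (tnth v i).
  - move: (congr1 (fun w => tnth w i) eq1).
    by rewrite eq2 tnth_flip eqxx -eq2 u_i.
rewrite -sum1_card (eq_bigl (fun x => (x.1 \in V) && tnth x.1 x.2)); last first.
  by move=> x; rewrite inE.
rewrite -(pair_big_dep (mem V) (fun u i => tnth u i) (fun _ _ => 1)) /=.
by apply: eq_bigr => u _; rewrite -sum1_count big_tuple.
Qed.

(** * Counting words and their ones by first letter *)

Lemma big_tuple0 (P : pred (seq bool)) (F : seq bool -> nat) : P [::] ->
  \sum_(u : 0.-tuple bool | P u) F u = F [::].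
Proof.
move=> P0; rewrite (big_pred1 [tuple]) // => u.
by rewrite [u]tuple0 P0 [RHS]eqxx.
Qed.

Lemma big_tuple_cons n (P : pred (seq bool)) (F : seq bool -> nat) :
  \sum_(u : n.+1.-tuple bool | P u) F u =
    \sum_(u : n.-tuple bool | P (true :: u)) F (true :: u) +
    \sum_(u : n.-tuple bool | P (false :: u)) F (false :: u).
Proof.
rewrite (reindex (fun x : bool * n.-tuple bool => [tuple of x.1 :: x.2])) /=.
  rewrite -(pair_big_dep xpredT (fun b (u : n.-tuple bool) => P (b :: u))
    (fun b (u : n.-tuple bool) => F (b :: u))) /=.
  by rewrite big_bool.
exists (fun u => (thead u, [tuple of behead u])) => [[b u] _ | u _].
  by congr (_, _); apply: val_inj.
by rewrite -tuple_eta.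
Qed.

Section Counting.

Variable p : nat.

Definition num_words r n := \sum_(u : n.-tuple bool | runs_le p r u) 1.

Definition num_ones r n := \sum_(u : n.-tuple bool | runs_le p r u) count id u.

Lemma num_wordsS r n :
  num_words r n.+1 =
    num_words p n + if r is r'.+1 then num_words r' n else 0.
Proof.
rewrite /num_words (big_tuple_cons n _ (fun=> 1)) addnC; congr (_ + _).
by case: r => // ; rewrite big_pred0.
Qed.

Lemma num_onesS r n :
  num_ones r n.+1 =
    num_ones p n +
      if r is r'.+1 then num_words r' n + num_ones r' n else 0.
Proof.
rewrite /num_ones (big_tuple_cons n _ (count id)) addnC; congr (_ + _).
case: r => [|r]; first by rewrite big_pred0.
by rewrite -big_split.
Qed.

Local Notation G := (kfib p.+1).

Lemma kfib_recS n : G (p + n).+1 = \sum_(0 <= j < p.+1) G (p + n - j).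
Proof.
rewrite kfib_rec //; last lia.
rewrite big_add1 /=; apply: eq_bigr => j _; congr (G _); lia.
Qed.

Lemma kfib_lt n : n < p -> G n = 0.
Proof. exact: (@kfib_small p.+1). Qed.

Lemma kfib_p : G p = 1.
Proof. exact: (kfib_init p.+1). Qed.

Lemma muln_kfib_sub j : j <= p -> j * G (p - j) = 0.
Proof. by case: j => // j le_jp; rewrite kfib_lt ?muln0 //; lia. Qed.

(** The summand at [j] counts the words with leading run exactly [j]: [G p = 1] is the all-ones
    word, and smaller indices give 0. *)
Lemma num_wordsE r n : r <= p ->
  num_words r n = \sum_(0 <= j < r.+1) G (p + n - j).
Proof.
elim: n r => [|n IHn] r le_rp.
  rewrite /num_words (@big_tuple0 _ (fun=> 1)) //.
  rewrite big_nat_recl // addn0 subn0 kfib_p big_nat big1 // => j ltj.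
  by rewrite kfib_lt //; lia.
rewrite num_wordsS IHn // -kfib_recS big_nat_recl // subn0 addnS; congr (_ + _).
case: r le_rp => [|r] le_rp; first by rewrite big_geq.
by rewrite IHn 1?ltnW //; apply: eq_bigr => j _; rewrite subSS.
Qed.

(** * Self-convolution and the recurrence for the number of ones *)

Definition kfib_conv m := \sum_(0 <= i < m.+1) G i * G (m - i).

Lemma kfib_conv_lt m : m < p.*2 -> kfib_conv m = 0.
Proof.
move=> lt_m; rewrite /kfib_conv big_nat big1 // => i lei.
case: (ltnP i p) => [lt_ip | le_pi]; first by rewrite kfib_lt.
by rewrite [G (m - i)]kfib_lt ?muln0 //; lia.
Qed.

Lemma kfib_convE m : kfib_conv (p.*2 + m) =
  \sum_(p <= i < (p + m).+1) G i * G (p.*2 + m - i).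
Proof.
rewrite /kfib_conv (big_cat_nat (n := p)) //=; last lia.
rewrite big_nat big1 => [|i /andP[_ lti]]; last by rewrite kfib_lt.
rewrite add0n (big_cat_nat (n := (p + m).+1)) //=; try lia.
rewrite [X in _ + X]big_nat [X in _ + X]big1 ?addn0 // => i lei.
by rewrite [G (_ - i)]kfib_lt ?muln0 //; lia.
Qed.

(** Expand the factor [G i] by its recurrence for [i > p] and swap the sums; the term [i = p], where
    the recurrence fails, leaves [G (m - p)]. *)
Lemma kfib_conv_rec m : p < m ->
  kfib_conv m = G (m - p) + \sum_(1 <= j < p.+2) kfib_conv (m - j).
Proof.
move=> lt_pm; rewrite {1}/kfib_conv (big_cat_nat (n := p)) //=; last lia.
rewrite big_nat big1 => [|i /andP[_ lti]]; last by rewrite kfib_lt.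
rewrite add0n big_ltn; last lia.
rewrite kfib_p mul1n; congr (_ + _).
under eq_big_nat => i lei.
  rewrite kfib_rec //; last lia.
  rewrite big_distrl /=.
  over.
rewrite exchange_big_nat /=.
apply: eq_big_nat => j lej.
(* Shifting by [j] makes the index start at [p.+1 - j]; the terms below have index less than [p] and
   vanish. *)
rewrite /kfib_conv [RHS](big_cat_nat (n := p.+1 - j)) //=; try lia.
rewrite [X in _ = X + _]big_nat [X in _ = X + _]big1 => [|i lei]; last first.
  by rewrite kfib_lt //; lia.
rewrite add0n -{1}(subnK (n := p.+1) (m := j)); last lia.
rewrite big_addn (_ : m.+1 - j = (m - j).+1); last lia.
apply: eq_big_nat => i lei; congr (G _ * G _); lia.
Qed.

(* The right-hand side of the theorem is [ones_formula (p.*2 + n)]: the terms of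
   [kfib_conv] outside the stated range vanish. With this offset, [m - j] is
   never truncated to a nonzero value of [kfib_conv]. *)
Definition ones_formula m := \sum_(1 <= j < p.+1) j * kfib_conv (m - j).

Lemma ones_formula_le m : m <= p.*2 -> ones_formula m = 0.
Proof.
move=> le_m; rewrite /ones_formula big_nat big1 // => j lej.
by rewrite kfib_conv_lt ?muln0 //; lia.
Qed.

(** The weights [j] turn the inhomogeneous terms of [kfib_conv_rec] into the ones held by leading
    runs of length [j]. *)
Lemma ones_formula_rec n :
  ones_formula (p.*2 + n.+1) =
    \sum_(0 <= j < p.+1) (j * G (p + n.+1 - j) + ones_formula (p.*2 + n - j)).
Proof.
rewrite big_split /= [X in _ = X + _]big_ltn // mul0n add0n.
rewrite /ones_formula exchange_big_nat /= -big_split /=.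
apply: eq_big_nat => j lej; rewrite kfib_conv_rec; last lia.
rewrite mulnDr big_distrr /= [X in _ + X]big_add1 /=.
congr (_ * G _ + _); first lia.
by apply: eq_bigr => i _; congr (_ * kfib_conv _); lia.
Qed.

(* Split on the length [j] of the leading run of ones: [1^j 0 w] has [j] more
   ones than [w]. *)
Lemma num_ones_runs r n : r <= p ->
  num_ones r n =
    \sum_(0 <= j < r.+1) (j * G (p + n - j) + ones_formula (p.*2 + n - j.+1)).
Proof.
elim: n r => [|n IHn] r le_rp.
  rewrite /num_ones (@big_tuple0 _ (count id)) //=.
  rewrite big_nat big1 // => j lej.
  by rewrite addn0 muln_kfib_sub ?ones_formula_le; lia.
rewrite num_onesS big_nat_recl // mul0n add0n; congr (_ + _).
  rewrite (IHn p) // addnS subn1 /=.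
  case: n {IHn} => [|n].
    rewrite [RHS]ones_formula_le ?addn0 // big_nat big1 // => j lej.
    by rewrite muln_kfib_sub ?ones_formula_le; lia.
  rewrite ones_formula_rec; apply: eq_bigr => j _.
  by congr (_ + ones_formula _); lia.
case: r le_rp => [|r] le_rp; first by rewrite big_geq.
rewrite num_wordsE ?IHn 1?ltnW // -big_split /=; apply: eq_bigr => j _.
by rewrite addnA mulSn !addnS !subSS.
Qed.

Lemma num_onesE n : 0 < n -> num_ones p n = ones_formula (p.*2 + n).
Proof.
case: n => // n _; rewrite num_ones_runs // ones_formula_rec.
by apply: eq_bigr => j _; rewrite !addnS subSS.
Qed.

End Counting.

Theorem theorem3p2 (k n : nat) (hk : 2 <= k) (hn : 1 <= n) :
  #|fibcube_edges k n| =
    \sum_(1 <= j < k)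
      (j * \sum_(k - 1 <= i < (n + k - 1 - j).+1)
             kfib k i * kfib k (n + 2 * k - 2 - j - i)).
Proof.
rewrite card_fibcube_edges 1?ltnW //; case: k hk => // p _.
rewrite (eq_bigl (fun u : n.-tuple bool => runs_le p p u)); last first.
  by move=> u; rewrite inE runs_le_infix.
rewrite -/(num_ones p p n) num_onesE //; apply: eq_big_nat => j lej.
(* For [j > n] the stated range is empty and the convolution index is below [p.*2], so both sides
   are 0. *)
congr (_ * _); case: (leqP j n) => [le_jn | lt_nj]; last first.
  by rewrite kfib_conv_lt ?big_geq; lia.
rewrite -addnBA // kfib_convE (_ : n + p.+1 - 1 - j = p + (n - j)); last lia.
rewrite subn1.
by apply: eq_bigr => i _; congr (_ * kfib _ _); lia.
Qed.
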